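(* For every constant $\delta>0$ there exists a constant $C>0$ such that the following holds. For every sufficiently large $d\in\mathbb{N}$, there exist infinitely many $n$ for which there exists an $(n,d,\lambda)$-graph $G$ with $\lambda/d\le\delta$ satisfying $$\mu(G)\le \exp\left\{\frac{Cn\log d}{d}\right\}.$$
   Context: Graphs are finite and simple. Given a $d$-regular graph $G$ on $n$ vertices, let $d=\lambda_1\ge \lambda_2\ge\cdots\ge\lambda_n$ be the eigenvalues of its adjacency matrix (with multiplicity) and let $\lambda=\max\{|\lambda_2|,|\lambda_n|\}$; then $G$ is called an $(n,d,\lambda)$-graph. For a graph $G$, $\mu(G)$ denotes the number of non-isomorphic induced subgraphs of $G$, that is, the number of isomorphism classes of graphs of the form $G[S]$ with $S\subseteq V(G)$. ''Sufficiently large $d$'' means $d\ge d_1$ for some $d_1$ depending only on $\delta$. *)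

(* Defs.v *)
From HB Require Import structures.
From mathcomp Require Import all_boot all_order all_algebra.
From mathcomp Require Import boolp reals.

Set Implicit Arguments.
Unset Strict Implicit.
Unset Printing Implicit Defensive.

Import Order.TTheory GRing.Theory Num.Theory.
Local Open Scope ring_scope.

Record sgraph (V : finType) := SGraph {
  adj : rel V;
  adj_sym : symmetric adj;
  adj_irr : irreflexive adj
}.

Definition regular (V : finType) (G : sgraph V) (d : nat) : Prop :=
  forall x : V, #|[set y | adj G x y]| = d.

Definition graph_iso (V W : finType) (G : sgraph V) (H : sgraph W) : Prop :=
  exists2 f : V -> W, bijective f & forall x y, adj H (f x) (f y) = adj G x y.

Section Induced.
Variables (V : finType) (G : sgraph V) (S : {set V}).

Let ind_adj : rel {x : V | x \in S} := fun x y => adj G (val x) (val y).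

Fact ind_adj_sym : symmetric ind_adj.
Proof. by move=> x y; apply: adj_sym. Qed.

Fact ind_adj_irr : irreflexive ind_adj.
Proof. by move=> x; apply: adj_irr. Qed.

Definition induced : sgraph {x : V | x \in S} := SGraph ind_adj_sym ind_adj_irr.
End Induced.

Definition induced_iso (V : finType) (G : sgraph V) : rel {set V} :=
  fun S T => `[< graph_iso (induced G S) (induced G T) >].

Lemma induced_iso_equiv (V : finType) (G : sgraph V) :
  equivalence_rel (induced_iso G).
Proof.
move=> S T U; split; first by apply/asboolP; exists id => //; exists id.
move=> /asboolP[f [f' fK f'K] fG]; apply/asboolP/asboolP => -[g gbij gG].
- exists (g \o f') => [|x y]; first by apply: bij_comp => //; exists f.
  by rewrite [LHS]gG -fG !f'K.
- exists (g \o f) => [|x y]; first by apply: bij_comp => //; exists f'.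
  by rewrite [LHS]gG fG.
Qed.

Definition mu (V : finType) (G : sgraph V) : nat :=
  #|equivalence_partition (induced_iso G) [set: {set V}]|.

Definition adj_mx (R : realType) (n : nat) (G : sgraph 'I_n) : 'M[R]_n :=
  \matrix_(i, j) (adj G i j)%:R.

(* [s] lists all the eigenvalues of [A], with multiplicity, in nonincreasing
   order; there is at most one such [s] *)
Definition spectrum (R : realType) (n : nat) (A : 'M[R]_n) (s : seq R) : Prop :=
  sorted >=%R s /\ char_poly A = \prod_(x <- s) ('X - x%:P).

(* with 0-based indices, lambda_2 is [s`_1] and lambda_n is [s`_n.-1] *)
Definition ndl_graph (R : realType) (n d : nat) (lambda : R)
    (G : sgraph 'I_n) : Prop :=
  regular G d /\
  exists2 s : seq R, spectrum (adj_mx R G) s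
    & lambda = Num.max `|s`_1| `|s`_n.-1|.

(* Main.v *)
Require Import Defs.
From HB Require Import structures.
From mathcomp Require Import all_boot all_order all_algebra.
From mathcomp Require Import perm finfield complex ring lra zify.
From mathcomp Require Import boolp reals sequences exp.

(** Blowing up a graph, that is replacing each vertex by [k] independent twins,
    multiplies its degree and its eigenvalues by [k] (the new eigenvalues are 0),
    while an induced subgraph of the blow-up is determined up to isomorphism by the
    number of twins of each vertex that it keeps.  So if [H] is a [D]-regular graph
    of small ratio [lambda / D] on [m] vertices, its blow-up [G] is [k D]-regular on
    [n = k m] vertices, has the same ratio, and
    [mu G <= (k + 1) ^ m = exp (O (n log d / d))], where [D] depends on [delta]
    only.

    For a degree [d = k D + r] with [r < D], an [r]-regular graph has to be added
    without spoiling the count.  The vertices of [H] are grouped in blocks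
    [{b} * Q] without inner edges, where [Q] is a group of exponent 2 with at least
    [D] elements, and each of the [k] copies of a block receives the same Cayley
    graph of degree [r].  The copies of a block can still be permuted freely, so an
    induced subgraph is determined by a multiset of [k] subsets of [Q] for each
    block ([mu_blowup]), and the added graph changes the eigenvalues by at most [r],
    which is small compared to [d].

    It remains to find infinitely many [H] of bounded degree ([dense_template]).
    A variant of Margulis's construction yields 5-regular multigraphs on the plane
    over [F_2^n] with a uniform spectral gap: by Fourier analysis the gap reduces to
    a ping-pong argument for two shears on pairs of polynomials over [F_2]
    ([ping_pong], [base_spectral_gap]).  A high power makes the ratio small, and the
    loops and multiple edges of that power are removed by tensoring with a complete
    graph and by replacing multiple edges with point-line incidences of an affine
    plane.  These steps and the blow-up replace each vertex by a cloud, and their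
    eigenvalues are all bounded by [contracts_cloud]. *)

Set Implicit Arguments.
Unset Strict Implicit.
Unset Printing Implicit Defensive.

Import Order.TTheory GRing.Theory Num.Theory.
Local Open Scope ring_scope.

(** * Eigenvalues of regular graphs *)

(** The complex spectral theorem gives a complex change of basis to a real
    diagonal matrix; two real matrices similar over the complex numbers are
    similar over the reals. *)
Lemma sym_diagonalizable (R : realType) n (A : 'M[R]_n) : A^T = A ->
  exists (P : 'M[R]_n) (D : 'rV[R]_n),
    P \in unitmx /\ P *m A = diag_mx D *m P.
Proof.
move=> symA; pose rc := real_complex R.
have real_rc m p (M : 'M[R]_(m, p)) : map_mx rc M \is a mxOver Num.real.
  by apply/mxOverP=> i j; rewrite mxE; apply/complex_realP; exists (M i j).
have hermA : map_mx rc A \is hermsymmx.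
  apply: realsym_hermsym => //; apply/is_hermitianmxP.
  by rewrite expr0 scale1r map_mx_id // map_trmx symA.
have spA := orthomx_spectralP (hermitian_normalmx hermA).
set Q := spectralmx _ in spA; set sp := spectral_diag _ in spA.
have unitQ : Q \in unitmx := spectral_unit _.
have real_sp : sp \is a mxOver Num.real := hermitian_spectral_diag_real hermA.
pose D := map_mx (@complex.Re R) sp.
have spE : sp = map_mx rc D.
  apply/matrixP=> i j; rewrite !mxE; apply/esym/RRe_real.
  exact: (mxOverP real_sp).
have diagE : diag_mx sp = map_mx rc (diag_mx D) by rewrite map_diag_mx -spE.
have [] // := @real_similar _ _ (map_mx rc A) (map_mx rc (diag_mx D)).
  exists Q => //; apply/similarP => //.
  by rewrite {1}spA -diagE !mulmxA mulmxV // mul1mx.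
move=> P /andP[/= realP unitP] /(similarP unitP) PA.
have PE : P = map_mx rc (map_mx (@complex.Re R) P).
  apply/matrixP=> i j; rewrite !mxE; apply/esym/RRe_real.
  exact: (mxOverP realP).
exists (map_mx (@complex.Re R) P), D; split.
  by rewrite -(map_unitmx rc) -PE.
apply: (@map_mx_inj _ _ rc).
by rewrite !map_mxM -PE.
Qed.

Lemma char_poly_diagonalized (R : fieldType) n (A P : 'M[R]_n) (D : 'rV[R]_n) :
  P \in unitmx -> P *m A = diag_mx D *m P ->
  char_poly A = \prod_i ('X - (D 0 i)%:P).
Proof.
move=> unitP PA; have -> : \prod_i ('X - (D 0 i)%:P) = char_poly (diag_mx D).
  rewrite char_poly_trig ?diag_mx_is_trig //.
  by apply: eq_bigr => i _; rewrite mxE eqxx.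
have detP : \det (map_mx polyC P) != 0.
  by rewrite det_map_mx polyC_eq0 -unitfE -unitmxE.
apply: (mulfI detP); rewrite /char_poly -det_mulmx mulrC -det_mulmx.
by rewrite /char_poly_mx mulmxBr mulmxBl -!map_mxM PA scalar_mxC.
Qed.

(** For a symmetric [K] with constant row sums this bounds every eigenvalue but
    the trivial one.  The factor is kept squared, so that square roots never
    occur. *)
Definition contracts (R : numDomainType) (V : finType) (K : V -> V -> R) (c : R) :=
  forall f : V -> R, \sum_x f x = 0 ->
    \sum_x (\sum_y K x y * f y) ^+ 2 <= c * \sum_x f x ^+ 2.

Lemma sum_sqr_gt0 (R : realDomainType) (V : finType) (f : V -> R) x :
  f x != 0 -> 0 < \sum_y f y ^+ 2.
Proof.
move=> fx; rewrite (bigD1 x) //= ltr_pwDl ?exprn_even_gt0 //.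
by apply: sumr_ge0 => y _; apply: sqr_ge0.
Qed.

(** An eigenvector for an eigenvalue other than [d] sums to zero, so the
    contraction bounds that eigenvalue.  The eigenvalue [d] is simple: from two
    independent eigenvectors a nonzero mean-zero combination could be formed, and
    it would violate [c < d ^ 2].  Hence in the sorted spectrum only the entry of
    index 0 is [d], and the entries [s`_1] and [s`_n.-1] are bounded. *)
Lemma ndl_of_contracts (R : realType) n d (c : R) (G : sgraph 'I_n) :
  (1 < n)%N -> regular G d -> c < d%:R ^+ 2 ->
  contracts (fun i j => (adj G i j)%:R) c ->
  exists lambda : R, [/\ ndl_graph d lambda G, 0 <= lambda & lambda ^+ 2 <= c].
Proof.
move=> n_gt1 regG cd conG; pose A := adj_mx R G.
have symA : A^T = A by apply/matrixP=> i j; rewrite !mxE adj_sym.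
have [P [D [unitP PA]]] := sym_diagonalizable symA.
have charA := char_poly_diagonalized unitP PA.
have eigP (u : 'rV[R]_n) a : u *m A = a *: u ->
    (forall i, \sum_j A i j * u 0 j = a * u 0 i) /\
    (a == d%:R) || (\sum_j u 0 j == 0).
  move=> uA; have eqA i : \sum_j A i j * u 0 j = a * u 0 i.
    move/matrixP: uA => /(_ 0 i); rewrite !mxE => <-.
    by apply: eq_bigr => j _; rewrite !mxE adj_sym mulrC.
  split=> //; rewrite -subr_eq0 -mulf_eq0 mulrBl !mulr_sumr subr_eq0.
  apply/eqP; under eq_bigr do rewrite -eqA.
  rewrite exchange_big; apply: eq_bigr => j _; rewrite -mulr_suml; congr (_ * _).
  under eq_bigr do rewrite mxE adj_sym; rewrite -(regG j) -sum1_card natr_sum.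
  rewrite [RHS](eq_bigl (fun i => adj G j i)) => [|i]; last by rewrite inE.
  by rewrite [RHS]big_mkcond; apply: eq_bigr => i _; case: ifP.
have eig_le (u : 'rV[R]_n) a : u != 0 -> u *m A = a *: u ->
    \sum_j u 0 j = 0 -> a ^+ 2 <= c.
  move=> u0 /eigP[eqA _] su.
  have [j uj] : exists j, u 0 j != 0.
    apply/existsP; apply: contraNT u0 => /existsPn /= u0; apply/eqP.
    by apply/rowP=> j; rewrite mxE; apply/eqP/negPn/u0.
  have := conG (u 0) su; rewrite (eq_bigr (fun i => a ^+ 2 * u 0 i ^+ 2)).
    by rewrite -mulr_sumr ler_pM2r // (sum_sqr_gt0 uj).
  move=> i _; rewrite -exprMn -eqA; congr (_ ^+ 2).
  by apply: eq_bigr => k _; rewrite mxE.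
have rowA i : row i P *m A = D 0 i *: row i P.
  rewrite -row_mul PA; apply/rowP=> j; rewrite !mxE (bigD1 i) //=.
  rewrite big1 ?addr0 ?mxE ?eqxx ?mulr1n //.
  by move=> k ki; rewrite mxE eq_sym (negPf ki) mul0r.
have freeP (u : 'rV[R]_n) : u *m P = 0 -> u = 0.
  by move=> uP; rewrite -[u](mulmxK unitP) uP mul0mx.
have row0 i : row i P != 0.
  apply/eqP=> r0; have /rowP/(_ i) : delta_mx 0 i = 0 :> 'rV[R]_n.
    by apply: freeP; rewrite -rowE.
  by rewrite !mxE !eqxx => /eqP; rewrite oner_eq0.
have D_le i : D 0 i != d%:R -> D 0 i ^+ 2 <= c.
  move=> Di; have [_] := eigP _ _ (rowA i); rewrite (negPf Di) => /eqP.
  exact: eig_le (row0 i) (rowA i).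
have uniq_d i j : D 0 i = d%:R -> D 0 j = d%:R -> i = j.
  move=> Di Dj; apply/eqP/negPn/negP=> ij.
  pose si := \sum_k row i P 0 k; pose sj := \sum_k row j P 0 k.
  suff [u [u0 uA us]] : exists u : 'rV[R]_n,
      [/\ u != 0, u *m A = d%:R *: u & \sum_k u 0 k = 0].
    by have := eig_le u d%:R u0 uA us; rewrite leNgt cd.
  have [si0|si0] := eqVneq si 0; first by exists (row i P); split; rewrite -?Di.
  exists (sj *: row i P - si *: row j P); split.
  - apply/eqP; rewrite !rowE !scalemxAl -mulmxBl => /freeP/rowP/(_ j).
    rewrite !mxE !eqxx /= (eq_sym j i) (negPf ij) /= mulr0 mulr1 add0r => /eqP.
    by rewrite oppr_eq0 (negPf si0).
  - by rewrite mulmxBl -!scalemxAl !rowA Di Dj scalerBr !scalerA !(mulrC d%:R).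
  - transitivity (sj * si - si * sj); last by rewrite mulrC subrr.
    rewrite /si /sj !mulr_sumr -sumrB.
    by apply: eq_bigr => k _; rewrite !mxE.
(* sorting the indices rather than the values keeps track of multiplicities *)
pose t := sort (fun i j => D 0 i >= D 0 j) (enum 'I_n).
pose s := [seq D 0 i | i <- t].
have size_t : size t = n by rewrite size_sort size_enum_ord.
have s_sorted : sorted >=%R s.
  by rewrite sorted_map; apply: sort_sorted => i j; apply: le_total.
have s_le k : (0 < k < n)%N -> s`_k ^+ 2 <= c.
  move=> /andP[k0 kn]; have i0 : 'I_n by exists k.
  have ge_k : s`_k <= s`_0.
    have ge_tr : transitive (fun x y : R => x >= y).
      by move=> x y z yx zy; apply: le_trans yx.
    apply: (sorted_ltn_nth ge_tr 0 s_sorted) => //; rewrite inE size_map size_t //.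
    by lia.
  move: ge_k; rewrite !(nth_map i0) ?size_t //; last by lia.
  have [Dk ge_k|/D_le //] := eqVneq (D 0 (nth i0 t k)) d%:R.
  have [D0|/D_le D0] := eqVneq (D 0 (nth i0 t 0)) d%:R.
    have /eqP := uniq_d _ _ Dk D0.
    rewrite nth_uniq ?size_t //; first by move/eqP=> k0'; rewrite k0' in k0.
      by lia.
    by rewrite sort_uniq enum_uniq.
  exfalso; move: (le_lt_trans D0 cd); rewrite Dk in ge_k.
  by rewrite ltr_pXn2r ?nnegrE ?ler0n // ?ltNge ?ge_k // (le_trans _ ge_k) ?ler0n.
exists (Num.max `|s`_1| `|s`_n.-1|); split.
- split=> //; exists s => //; split=> //.
  by rewrite charA /s big_map (perm_big _ (permEl (perm_sort _ _))) /= big_enum.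
- by rewrite le_max normr_ge0.
- by case: (leP `|s`_1|) => _; rewrite real_normK ?num_real ?s_le //; lia.
Qed.

(** * Replacing vertices by clouds *)

Lemma weighted_cauchy_schwarz (R : realFieldType) (I : finType) (a u : I -> R) :
  (forall i, 0 <= a i) ->
  (\sum_i a i * u i) ^+ 2 <= (\sum_i a i) * \sum_i a i * u i ^+ 2.
Proof.
move=> a_ge0.
(* Lagrange's identity *)
have: 0 <= \sum_i \sum_j a i * a j * (u i - u j) ^+ 2.
  apply: sumr_ge0 => i _; apply: sumr_ge0 => j _.
  by apply: mulr_ge0; rewrite ?sqr_ge0 ?mulr_ge0.
have -> : \sum_i \sum_j a i * a j * (u i - u j) ^+ 2 =
    ((\sum_i a i) * (\sum_i a i * u i ^+ 2) - (\sum_i a i * u i) ^+ 2) *+ 2.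
  transitivity ((\sum_i a i) * (\sum_i a i * u i ^+ 2) +
      (\sum_i a i * u i ^+ 2) * (\sum_i a i) -
      ((\sum_i a i * u i) * (\sum_i a i * u i)) *+ 2).
    2: by rewrite [_ * (\sum_i a i)]mulrC expr2 mulrnBl [in RHS]mulr2n.
  rewrite !big_distrlr -sumrMnl -big_split -sumrB /=; apply: eq_bigr => i _.
  by rewrite -sumrMnl -big_split -sumrB /=; apply: eq_bigr => j _; ring.
by rewrite pmulrn_lge0 // subr_ge0.
Qed.

Lemma sum_pairE (R : nmodType) (V W : finType) (F : V * W -> R) :
  \sum_p F p = \sum_v \sum_w F (v, w).
Proof. by rewrite pair_big; apply: eq_bigr => -[]. Qed.

(** Replacing every vertex by a cloud [W].  Split [f] into its averages [b] over
    the clouds and the mean-zero remainders [g].  On [b] the kernel [M] acts as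
    [r] times [A], on [g] the hypothesis on the blocks applies; regularity makes
    the images of the two parts orthogonal, so the bounds do not add up: the
    larger one suffices. *)
Lemma contracts_cloud (R : realFieldType) (V W : finType) (A : V -> V -> R)
    (M : V * W -> V * W -> R) (D r th tau c : R) :
  (0 < #|W|)%N -> (forall v v', 0 <= A v v') ->
  (forall v, \sum_v' A v v' = D) -> (forall v', \sum_v A v v' = D) ->
  (forall v v' w, \sum_w' M (v, w) (v', w') = r * A v v') ->
  (forall v v' w', \sum_w M (v, w) (v', w') = r * A v v') ->
  contracts A th ->
  (forall v v', contracts (fun w w' => M (v, w) (v', w')) (A v v' ^+ 2 * tau)) ->
  r ^+ 2 * th <= c -> D ^+ 2 * tau <= c -> contracts M c.
Proof.
move=> W0 A0 Arow Acol Mrow Mcol conA conM thc tauc f sf.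
have N0 : #|W|%:R != 0 :> R by rewrite pnatr_eq0 -lt0n.
pose b v := (\sum_w f (v, w)) / #|W|%:R.
pose g v w := f (v, w) - b v.
have sg v : \sum_w g v w = 0.
  by rewrite sumrB sumr_const -mulr_natr divfK ?subrr.
have sb : \sum_v b v = 0 by rewrite -mulr_suml -sum_pairE sf mul0r.
pose beta v := r * \sum_v' A v v' * b v'.
pose e v v' w := \sum_w' M (v, w) (v', w') * g v' w'.
have normD (x : R) (h : W -> R) : \sum_w h w = 0 ->
    \sum_w (x + h w) ^+ 2 = #|W|%:R * x ^+ 2 + \sum_w h w ^+ 2.
  move=> sh; under eq_bigr do rewrite sqrrD -mulr_natr.
  rewrite !big_split /= [X in _ + X + _](_ : _ = 0).
    by rewrite addr0 sumr_const mulr_natl.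
  by rewrite -mulr_suml -mulr_sumr sh mulr0 mul0r.
have MfE v w : \sum_p M (v, w) p * f p = beta v + \sum_v' e v v' w.
  rewrite sum_pairE /beta mulr_sumr -big_split; apply: eq_bigr => v' _ /=.
  rewrite mulrA -(Mrow v v' w) mulr_suml -big_split; apply: eq_bigr => w' _ /=.
  by rewrite -mulrDr /g addrC subrK.
have se v : \sum_w \sum_v' e v v' w = 0.
  rewrite exchange_big big1 // => v' _; rewrite /e exchange_big /=.
  under eq_bigr do rewrite -mulr_suml Mcol.
  by rewrite -mulr_sumr sg mulr0.
have fE : \sum_p f p ^+ 2 =
    #|W|%:R * \sum_v b v ^+ 2 + \sum_v \sum_w g v w ^+ 2.
  rewrite sum_pairE mulr_sumr -big_split; apply: eq_bigr => v _ /=.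
  by rewrite -normD //; apply: eq_bigr => w _; rewrite /g addrC subrK.
have e_le v v' : \sum_w e v v' w ^+ 2 <= A v v' ^+ 2 * tau * \sum_w g v' w ^+ 2.
  exact: conM.
have e0 v v' w : A v v' = 0 -> e v v' w = 0.
  move=> A00; apply/eqP; apply: contraT => en0.
  have := lt_le_trans (sum_sqr_gt0 en0) (e_le v v').
  by rewrite A00 expr0n /= !mul0r ltxx.
(* Cauchy-Schwarz with weights [A v v'], applied to the quotients [e / A] *)
have E_le v : \sum_w (\sum_v' e v v' w) ^+ 2 <=
    D * \sum_v' A v v' * tau * \sum_w g v' w ^+ 2.
  have D0 : 0 <= D by rewrite -(Arow v) sumr_ge0.
  pose u v' w := e v v' w / A v v'.
  have eE v' w : e v v' w = A v v' * u v' w.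
    rewrite /u mulrC; have [A00|A00] := eqVneq (A v v') 0; last by rewrite divfK.
    by rewrite A00 e0 // mulr0.
  apply: (@le_trans _ _ (\sum_w D * \sum_v' A v v' * u v' w ^+ 2)).
    apply: ler_sum => w _; under eq_bigr do rewrite eE.
    by rewrite -(Arow v) weighted_cauchy_schwarz.
  rewrite -mulr_sumr ler_wpM2l // exchange_big; apply: ler_sum => v' _ /=.
  rewrite -mulr_sumr -mulrA; have [->|A00] := eqVneq (A v v') 0; first by rewrite !mul0r.
  rewrite ler_wpM2l // -(ler_pM2l (_ : 0 < A v v' ^+ 2)); last first.
    by rewrite exprn_gt0 // lt_neqAle eq_sym A00 A0.
  rewrite mulrA mulr_sumr; apply: le_trans (e_le v v').
  by apply: ler_sum => w _; rewrite -exprMn -eE.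
have g_ge0 : 0 <= \sum_v \sum_w g v w ^+ 2.
  by apply: sumr_ge0 => v _; apply: sumr_ge0 => w _; apply: sqr_ge0.
have b_ge0 : 0 <= \sum_v b v ^+ 2.
  by apply: sumr_ge0 => v _; apply: sqr_ge0.
have -> : \sum_p (\sum_p' M p p' * f p') ^+ 2 =
    #|W|%:R * (r ^+ 2 * \sum_v (\sum_v' A v v' * b v') ^+ 2) +
    \sum_v \sum_w (\sum_v' e v v' w) ^+ 2.
  rewrite sum_pairE !mulr_sumr -big_split; apply: eq_bigr => v _ /=.
  by under eq_bigr do rewrite MfE; rewrite normD // /beta exprMn.
rewrite fE mulrDr lerD //.
  rewrite [leRHS]mulrCA ler_wpM2l ?ler0n //; apply: le_trans (ler_wpM2r b_ge0 thc).
  by rewrite -[leRHS]mulrA ler_wpM2l ?sqr_ge0 // conA.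
apply: le_trans (ler_wpM2r g_ge0 tauc).
apply: le_trans (ler_sum _ (fun v _ => E_le v)) _.
rewrite -mulr_sumr exchange_big /=.
under eq_bigr do rewrite -mulr_suml -mulr_suml Acol.
by rewrite -mulr_sumr !mulrA -expr2.
Qed.

(** Regular multigraphs with loops, given by the multiplicities of their edges:
    powers of a graph are of this kind. *)
Definition regular_kernel (V : finType) (A : V -> V -> nat) (D : nat) :=
  (forall x y, A x y = A y x) /\ (forall x, \sum_y A x y = D)%N.

(** By symmetry the column conditions of [contracts_cloud] follow from the row
    conditions. *)
Lemma regular_kernel_cloud (R : realFieldType) (V W : finType)
    (A : V -> V -> nat) (M : V * W -> V * W -> nat) (D r : nat) (th tau c : R) :
  (0 < #|W|)%N -> regular_kernel A D ->
  (forall p p', M p p' = M p' p) ->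
  (forall v v' w, \sum_w' M (v, w) (v', w') = r * A v v')%N ->
  contracts (fun x y => (A x y)%:R) th ->
  (forall v v', contracts (fun w w' => (M (v, w) (v', w'))%:R)
     ((A v v')%:R ^+ 2 * tau)) ->
  r%:R ^+ 2 * th <= c -> D%:R ^+ 2 * tau <= c ->
  regular_kernel M (r * D) /\ contracts (fun p p' => (M p p')%:R) c.
Proof.
move=> W0 [symA rowA] symM rowM conA conM thc tauc; split.
  split=> // -[v w]; rewrite -(rowA v) big_distrr /=.
  under [RHS]eq_bigr do rewrite -(rowM _ _ w).
  by rewrite pair_big; apply: eq_bigr => -[].
apply: (contracts_cloud W0 (A := fun x y => (A x y)%:R) (D := D%:R)
          (r := r%:R) _ _ _ _ _ conA conM thc tauc).
- by move=> v v'; rewrite ler0n.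
- by move=> v; rewrite -natr_sum rowA.
- by move=> v; rewrite -natr_sum -(rowA v); under eq_bigr do rewrite symA.
- by move=> v v' w; rewrite -natr_sum rowM natrM.
- by move=> v v' w; rewrite -natr_sum symA -natrM -(rowM _ _ w);
    under eq_bigr do rewrite symM.
Qed.

(** The tensor product with a complete graph on [Z]; it removes the loops of
    [A]. *)
Definition off_diagonal (V Z : finType) (A : V -> V -> nat) (p p' : V * Z) : nat :=
  (p.2 != p'.2) * A p.1 p'.1.

(** On mean-zero functions the complete graph acts as minus the identity. *)
Lemma regular_kernel_off_diagonal (R : realFieldType) (V Z : finType)
    (A : V -> V -> nat) (D t : nat) (th c : R) :
  #|Z| = t.+1 -> regular_kernel A D ->
  contracts (fun x y => (A x y)%:R) th ->
  t%:R ^+ 2 * th <= c -> D%:R ^+ 2 <= c ->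
  regular_kernel (@off_diagonal V Z A) (t * D) /\
  contracts (fun p p' => (@off_diagonal V Z A p p')%:R) c.
Proof.
move=> cardZ regA conA thc Dc; have [symA rowA] := regA.
apply: (regular_kernel_cloud (tau := 1) _ regA _ _ conA); rewrite ?mulr1 ?cardZ //.
- by move=> p p'; rewrite /off_diagonal eq_sym symA.
- move=> v v' z; rewrite /off_diagonal /= -big_distrl /=; congr (_ * _)%N.
  transitivity (\sum_(z' | z' != z) 1)%N.
    by rewrite [RHS]big_mkcond; apply: eq_bigr => z' _; rewrite eq_sym; case: eqP.
  by rewrite sum1_card cardC1 cardZ.
- move=> v v' f sf; rewrite mulr1 mulr_sumr; apply: ler_sum => z _.
  rewrite -exprMn -[leRHS]sqrrN -mulrN.
  have -> : - f z = \sum_z' (z != z')%:R * f z'.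
    rewrite [RHS](bigD1 z) //= eqxx /= mul0r add0r.
    apply/eqP; rewrite eq_sym -subr_eq0 opprK addrC; apply/eqP.
    transitivity (\sum_z' f z') => //; rewrite [RHS](bigD1 z) //=; congr (_ + _).
    by apply: eq_bigr => z' zz'; rewrite eq_sym zz' mul1r.
  rewrite mulr_sumr le_eqVlt; apply/orP; left; apply/eqP; congr (_ ^+ 2).
  by apply: eq_bigr => z' _; rewrite /off_diagonal /= natrM mulrA [_ * _%:R]mulrC.
Qed.

Section Incidence.
Variables (R : realFieldType) (F : finFieldType).
Local Notation q := #|F|.

(** Point-line incidence in the affine plane: two lines [y + x' x = a - y'] with
    different slopes meet in exactly one point, and two different lines with the
    same slope do not meet.  So the square of this kernel, whose entries count the
    common points of two lines, is [q] times the identity plus the matrix with entry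
    1 at the pairs of lines with different slopes.  The quadratic form of the latter
    is minus a sum of squares on mean-zero functions. *)
Lemma incidence_contracts (a : F) :
  contracts (fun u w : F * F => (u.2 + w.2 + u.1 * w.1 == a)%:R) (q%:R : R).
Proof.
move=> g; rewrite sum_pairE; pose s x := \sum_y g (x, y); rewrite -/(s _) => sg.
have TE x y : \sum_w ((x, y).2 + w.2 + (x, y).1 * w.1 == a)%:R * g w =
    \sum_x' g (x', (a - y) - x * x').
  rewrite sum_pairE; apply: eq_bigr => x' _.
  rewrite (bigD1 ((a - y) - x * x')) //= big1 ?addr0 => [|y' y'N].
    by rewrite (_ : _ == a) ?mul1r //; apply/eqP; ring.
  case: eqP => [/= ya|_]; last by rewrite mul0r.
  by move: y'N; rewrite -ya -subr_eq0 (_ : _ - _ = 0) ?eqxx //; ring.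
rewrite !sum_pairE.
(* the substitution [y := a - y] gets rid of [a] *)
have shiftE (h : F -> F -> R) : \sum_x \sum_y h x (a - y) = \sum_x \sum_y h x y.
  apply: eq_bigr => x _; rewrite (reindex_inj (_ : injective (fun y => a - y))) /=.
    by apply: eq_bigr => y _; congr (h _ _); ring.
  by move=> y y' /addrI/oppr_inj.
have crossE x' x'' : x' != x'' ->
    \sum_x \sum_y g (x', y - x * x') * g (x'', y - x * x'') = s x' * s x''.
  move=> x'x''; rewrite /s big_distrlr /= !pair_big /=.
  (* a point is determined by the two lines through it *)
  pose phi (p : F * F) := (p.2 - p.1 * x', p.2 - p.1 * x'').
  rewrite [RHS](reindex_inj (_ : injective phi)) /=; first by apply: eq_bigr => -[].
  move=> [x y] [z t] [e1 e2].
  have /eqP : (x - z) * (x' - x'') = 0.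
    have -> : (x - z) * (x' - x'') =
        (y - x * x'' - (y - x * x')) - (t - z * x'' - (t - z * x')) by ring.
    by rewrite e1 e2 subrr.
  rewrite mulf_eq0 !subr_eq0 (negPf x'x'') orbF => /eqP xz.
  by move: e1; rewrite xz => /addIr ->.
have diagE x' : \sum_x \sum_y g (x', y - x * x') * g (x', y - x * x') =
    q%:R * \sum_y g (x', y) ^+ 2.
  rewrite mulr_natl -sumr_const; apply: eq_bigr => x _.
  rewrite [RHS](reindex_inj (addIr (- (x * x')))) /=.
  by apply: eq_bigr => y _; rewrite expr2.
have -> : \sum_x \sum_y
    (\sum_w ((x, y).2 + w.2 + (x, y).1 * w.1 == a)%:R * g w) ^+ 2 =
    q%:R * \sum_x \sum_y g (x, y) ^+ 2 - \sum_x s x ^+ 2.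
  under eq_bigr do under eq_bigr do rewrite TE.
  rewrite (shiftE (fun x y => (\sum_x' g (x', y - x * x')) ^+ 2)).
  transitivity (\sum_x' \sum_x'' \sum_x \sum_y
      g (x', y - x * x') * g (x'', y - x * x'')).
    under eq_bigr do under eq_bigr do rewrite expr2 big_distrlr /=.
    under eq_bigr do rewrite exchange_big /=.
    rewrite exchange_big /=; apply: eq_bigr => x' _.
    under eq_bigr do rewrite exchange_big /=.
    by rewrite exchange_big.
  have ss x' : \sum_(x'' | x'' != x') s x' * s x'' = - s x' ^+ 2.
    apply/eqP; rewrite -addr_eq0 addrC expr2; apply/eqP.
    transitivity (\sum_x'' s x' * s x''); last by rewrite -mulr_sumr sg mulr0.
    by rewrite [RHS](bigD1 x').
  rewrite mulr_sumr -sumrB; apply: eq_bigr => x' _.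
  rewrite (bigD1 x') //= diagE -ss; congr (_ + _).
  by apply: eq_bigr => x'' xx; rewrite crossE // eq_sym.
by rewrite gerBl sumr_ge0 // => x _; apply: sqr_ge0.
Qed.
End Incidence.

(** An edge of multiplicity [m] of [A] becomes the union of [m] disjoint incidence
    relations, one for each of [m] field elements.  This turns a multigraph into a
    graph. *)
Definition incidence_lift (F : finFieldType) (V : finType) (A : V -> V -> nat) :
    rel (V * (F * F)) :=
  fun p p' => p.2.2 + p'.2.2 + p.2.1 * p'.2.1 \in take (A p.1 p'.1) (enum F).

Lemma regular_kernel_incidence_lift (R : realFieldType) (F : finFieldType)
    (V : finType) (A : V -> V -> nat) (D : nat) (th c : R) :
  (forall v v', A v v' <= #|F|)%N -> regular_kernel A D ->
  contracts (fun x y => (A x y)%:R) th ->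
  #|F|%:R ^+ 2 * th <= c -> D%:R ^+ 2 * #|F|%:R <= c ->
  regular_kernel (fun p p' => incidence_lift (F := F) A p p' : nat) (#|F| * D) /\
  contracts (fun p p' => (incidence_lift (F := F) A p p')%:R) c.
Proof.
move=> A_le regA conA thc Dc; have [symA rowA] := regA.
have card_take m : (m <= #|F|)%N -> #|[pred a in take m (enum F)]| = m.
  move=> mq; rewrite (card_uniqP _) ?take_uniq ?enum_uniq //.
  by rewrite size_takel // -cardE.
apply: (regular_kernel_cloud _ regA _ _ conA _ thc Dc).
- by apply/card_gt0P; exists 0.
- by move=> p p'; rewrite /incidence_lift symA [p.2.2 + _]addrC [p.2.1 * _]mulrC.
- move=> v v' [x y]; rewrite /incidence_lift /=.
  transitivity (\sum_(x' : F) \sum_(y' : F)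
      ((y + y' + x * x')%R \in take (A v v') (enum F)))%N.
    by rewrite pair_big; apply: eq_bigr => -[].
  rewrite -sum_nat_const; apply: eq_bigr => x' _.
  rewrite -[RHS](card_take _ (A_le v v')) -sum1_card [RHS]big_mkcond /=.
  rewrite [RHS](reindex_inj (addrI (y + x * x'))) /=.
  by apply: eq_bigr => y' _; rewrite addrAC inE.
- move=> v v' g sg; pose C := take (A v v') (enum F).
  pose T a w := \sum_w' (w.2 + w'.2 + w.1 * w'.1 == a)%:R * g w'.
  have sC : \sum_a (a \in C)%:R = (A v v')%:R :> R.
    by rewrite -natr_sum -big_mkcond /= sum1_card card_take.
  have TE w : \sum_w' (incidence_lift A (v, w) (v', w'))%:R * g w' =
      \sum_a (a \in C)%:R * T a w.
    rewrite /T; under [RHS]eq_bigr do rewrite mulr_sumr.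
    rewrite exchange_big /=; apply: eq_bigr => w' _.
    rewrite (bigD1 (w.2 + w'.2 + w.1 * w'.1)) //= eqxx mul1r big1 ?addr0 // => a.
    by rewrite eq_sym => /negPf->; rewrite mul0r mulr0.
  under eq_bigr do rewrite TE.
  apply: (@le_trans _ _ (\sum_w (A v v')%:R * \sum_a (a \in C)%:R * T a w ^+ 2)).
    apply: ler_sum => w _; rewrite -sC.
    by apply: weighted_cauchy_schwarz => a; rewrite ler0n.
  rewrite -mulr_sumr exchange_big /= expr2 -!mulrA ler_wpM2l ?ler0n //.
  rewrite -{1}sC mulr_suml; apply: ler_sum => a _.
  by rewrite -mulr_sumr ler_wpM2l ?ler0n // incidence_contracts.
Qed.

(** [(a + b)^2 <= 2 a^2 + 2 b^2] *)
Lemma contracts_add (R : realFieldType) (V : finType) (K L : V -> V -> R) (c d : R) :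
  contracts K c -> (forall f, \sum_x (\sum_y L x y * f y) ^+ 2 <= d * \sum_x f x ^+ 2) ->
  contracts (fun x y => K x y + L x y) (2 * c + 2 * d).
Proof.
move=> conK conL f sf; rewrite mulrDl -!mulrA.
apply: le_trans (lerD (ler_wpM2l (ler0n _ 2) (conK f sf))
  (ler_wpM2l (ler0n _ 2) (conL f))).
rewrite !mulr_sumr -big_split; apply: ler_sum => x _ /=.
under eq_bigr do rewrite mulrDl; rewrite big_split /=.
by rewrite -subr_ge0; set a := \sum_y _; set b := \sum_y _;
  rewrite (_ : _ - _ = (a - b) ^+ 2) ?sqr_ge0 //; ring.
Qed.

Lemma regular_kernel_bounded (R : realFieldType) (V : finType) (L : V -> V -> nat)
    (s : nat) (f : V -> R) : regular_kernel L s ->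
  \sum_x (\sum_y (L x y)%:R * f y) ^+ 2 <= s%:R ^+ 2 * \sum_x f x ^+ 2.
Proof.
move=> [symL rowL].
apply: (@le_trans _ _ (\sum_x s%:R * \sum_y (L x y)%:R * f y ^+ 2)).
  apply: ler_sum => x _; rewrite -(rowL x) natr_sum.
  by apply: weighted_cauchy_schwarz => y; rewrite ler0n.
rewrite -mulr_sumr exchange_big /= expr2 -mulrA ler_wpM2l ?ler0n //.
rewrite mulr_sumr; apply: ler_sum => y _; rewrite -mulr_suml -natr_sum -(rowL y).
by under eq_bigr do rewrite symL.
Qed.

(** * Fourier analysis on a finite abelian group *)

(** Products of finite abelian groups, so that [chi] below can live on a plane. *)
HB.instance Definition _ (U W : finZmodType) := Finite.on (U * W)%type.

Section Characters.
Variables (R : realFieldType) (U : finZmodType) (chi : U -> U -> R).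
Hypothesis chiDl : forall a b x, chi (a + b) x = chi a x * chi b x.
Hypothesis chiDr : forall a x y, chi a (x + y) = chi a x * chi a y.
Hypothesis chi_sqr : forall a x, chi a x ^+ 2 = 1.
Hypothesis chi_nondegenerate : forall x, x != 0 -> exists a, chi a x != 1.

Definition fourier (f : U -> R) (a : U) := \sum_x chi a x * f x.

Lemma sum_chi x : \sum_a chi a x = if x == 0 then #|U|%:R else 0.
Proof.
have chi0r a : chi a 0 = 1.
  have := chiDr a 0 0; rewrite addr0 -expr2 chi_sqr //.
case: eqVneq => [->|x0]; first by under eq_bigr do rewrite chi0r; rewrite sumr_const.
have [b chib] := chi_nondegenerate x0; apply/eqP.
have : (chi b x - 1) * \sum_a chi a x = 0.
  rewrite mulrBl mul1r mulr_sumr [X in _ - X](reindex_inj (addrI b)) /=.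
  by under [X in _ - X]eq_bigr do rewrite chiDl; rewrite subrr.
by move/eqP; rewrite mulf_eq0 subr_eq0 (negPf chib).
Qed.

Lemma parseval f : \sum_a fourier f a ^+ 2 = #|U|%:R * \sum_x f x ^+ 2.
Proof.
have chi_eq x y : \sum_a chi a x * chi a y = if x == y then #|U|%:R else 0.
  have [->|xy] := eqVneq x y.
    by under eq_bigr do rewrite -expr2 chi_sqr; rewrite sumr_const.
  transitivity (\sum_a chi a (x - y)); last by rewrite sum_chi subr_eq0 (negPf xy).
  apply: eq_bigr => a _; rewrite chiDr; congr (_ * _).
  have chiN : chi a (- y) * chi a y = 1.
    by rewrite -chiDr addNr -[RHS](chi_sqr a 0) expr2 -chiDr addr0.
  by rewrite -[LHS]mul1r -chiN -mulrA -expr2 chi_sqr mulr1.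
under eq_bigr do rewrite expr2 big_distrlr /=.
rewrite exchange_big /= mulr_sumr; apply: eq_bigr => x _.
rewrite exchange_big /=.
transitivity (\sum_y (if x == y then #|U|%:R else 0) * (f x * f y)).
  apply: eq_bigr => y _; rewrite -chi_eq mulr_suml.
  by apply: eq_bigr => a _; rewrite mulrACA.
rewrite (bigD1 x) //= eqxx -expr2 big1 ?addr0 // => y.
by rewrite eq_sym => /negPf->; rewrite mul0r.
Qed.

(** Moving the vertices by [g] moves the characters by the adjoint [g']. *)
Lemma fourier_diff_adjoint (g g' : U -> U) (f : U -> R) :
  involutive g -> (forall a x, chi a (g x) = chi (g' a) x) ->
  \sum_a (fourier f a - fourier f (g' a)) ^+ 2 =
  #|U|%:R * \sum_x (f x - f (g x)) ^+ 2.
Proof.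
move=> gK gg'; rewrite -parseval; apply: eq_bigr => a _; congr (_ ^+ 2).
rewrite /fourier -sumrB; under [RHS]eq_bigr do rewrite mulrBr; rewrite !sumrB.
congr (_ - _); rewrite [RHS](reindex_inj (can_inj gK)) /=.
by apply: eq_bigr => x _; rewrite gK gg'.
Qed.

(** A translation multiplies each Fourier coefficient by a value of its
    character. *)
Lemma fourier_diff_translation e (f : U -> R) :
  \sum_a ((1 - chi a e) * fourier f a) ^+ 2 =
  #|U|%:R * \sum_x (f x - f (x + e)) ^+ 2.
Proof.
rewrite -parseval; apply: eq_bigr => a _; congr (_ ^+ 2).
rewrite /fourier mulrBl mul1r; under [RHS]eq_bigr do rewrite mulrBr.
rewrite sumrB; congr (_ - _).
transitivity (chi a e * \sum_x chi a (x + e) * f (x + e)).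
  by congr (_ * _); rewrite (reindex_inj (addIr e)).
rewrite mulr_sumr; apply: eq_bigr => x _.
by rewrite chiDr -[RHS]mul1r -(chi_sqr a e); ring.
Qed.
End Characters.

(** * Ping-pong on pairs of polynomials over the field with two elements *)

Section Shears.
Variable m : nat.
Local Notation n := m.+1.
Local Notation V := 'rV['F_2]_n.

Lemma addvv (a : V) : a + a = 0.
Proof. by apply/rowP=> i; rewrite !mxE addrr_pchar2 ?pchar_Fp. Qed.

Lemma addvK (b : V) : involutive (fun a => a + b).
Proof. by move=> a; rewrite -addrA addvv addr0. Qed.

(** A vector is read as a polynomial of size at most [n], and [deg] is one more
    than its degree. *)
Definition deg (a : V) := size (rVpoly a).
(** Multiplication by ['X], the coefficient of degree [n] being dropped. *)
Definition mulX (a : V) : V := poly_rV ('X * rVpoly a).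

Fact mulX_is_linear : linear mulX.
Proof.
by move=> c a b; rewrite /mulX linearP mulrDr -scalerAr linearP.
Qed.
HB.instance Definition _ := GRing.isLinear.Build 'F_2 V V _ mulX mulX_is_linear.

Lemma deg_mulX (a : V) : a != 0 -> (deg a < n)%N -> deg (mulX a) = (deg a).+1.
Proof.
move=> a0 dega; have rva0 : rVpoly a != 0.
  by apply: contraNneq a0 => r0; rewrite -[a]rVpolyK r0 linear0.
by rewrite /deg /mulX poly_rV_K mulrC size_mulX.
Qed.

Lemma deg_gt0 (a : V) : (0 < deg a)%N = (a != 0).
Proof.
rewrite size_poly_gt0; congr (~~ _); apply/eqP/eqP=> [r0|->]; last exact: linear0.
by rewrite -[a]rVpolyK r0 linear0.
Qed.

Lemma degD_le (a b : V) : (deg (a + b) <= maxn (deg a) (deg b))%N.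
Proof. by rewrite /deg linearD size_polyD. Qed.

Lemma degD (a b : V) : (deg b < deg a)%N -> deg (a + b) = deg a.
Proof. by move=> ba; rewrite /deg linearD size_polyDl. Qed.

Lemma deg_lt (a : V) : a 0 ord_max = 0 -> (deg a < n)%N.
Proof.
move=> a0; rewrite ltnS; apply/leq_sizeP=> j; rewrite leq_eqVlt => /orP[/eqP<-|mj].
  by rewrite (coef_rVpoly_ord a ord_max).
by rewrite nth_default // (leq_trans (size_poly _ _)).
Qed.

(** [shear] and [shear1] add to the first coordinate the multiples of the second
    one by ['X] and by ['X + 1]. *)
Definition shear (a : V * V) : V * V := (a.1 + mulX a.2, a.2).
Definition shear1 (a : V * V) : V * V := (a.1 + a.2 + mulX a.2, a.2).
Definition swap (a : V * V) : V * V := (a.2, a.1).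

Lemma shearK : involutive shear.
Proof. by move=> [a b]; rewrite /shear /= addvK. Qed.

Lemma shear1K : involutive shear1.
Proof. by move=> [a b]; rewrite /shear1 /= addrAC addvK addvK. Qed.

Lemma swapK : involutive swap. Proof. by case. Qed.

(** A nonzero function on the plane cannot be nearly invariant.  Where the second
    coordinate can be multiplied by ['X] without truncation, both shears send the
    pairs with [deg a.1 < deg a.2] to pairs with [deg a.1 > deg a.2], and their
    images are disjoint; so the second region carries at least about twice the
    weight of the first.  The swap makes the two weights about equal, hence both are small, and so
    is that of the pairs of equal degree, which [shear] also sends to the second
    region.  Only the origin escapes, where [h] vanishes.  The last sum is the weight
    of the pairs where truncation occurs. *)
Lemma ping_pong (R : realFieldType) (h : V * V -> R)
    (E := fun g => \sum_a (h a - h (g a)) ^+ 2) : h 0 = 0 ->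
  \sum_a h a ^+ 2 <= 100 * (E shear + E shear1 + E swap +
    \sum_(a : V * V | a.2 0 ord_max != 0) h a ^+ 2).
Proof.
move=> h0; pose w (P : pred (V * V)) := \sum_(a | P a) h a ^+ 2.
set Ebad := \sum_(a : V * V | a.2 0 ord_max != 0) _.
pose X1 (a : V * V) := (deg a.2 < deg a.1)%N.
pose X2 (a : V * V) := (deg a.1 < deg a.2)%N.
pose X3 (a : V * V) := [&& deg a.1 == deg a.2, a.2 != 0 & a.2 0 ord_max == 0].
pose good (a : V * V) := a.2 0 ord_max == 0.
(* [5/4] is small enough: the weights of [X1] and [X2] get compared with the
   ratios 2 and [5/4], and [(5/4)^2 < 2] *)
have w_le g P : w P <= 5/4 * (\sum_(a | P a) h (g a) ^+ 2) + 5 * E g.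
  apply: (@le_trans _ _
    (\sum_(a | P a) (5/4 * h (g a) ^+ 2 + 5 * (h a - h (g a)) ^+ 2))).
    apply: ler_sum => a _; rewrite -subr_ge0.
    rewrite (_ : _ - _ = (2 * h a - 5 / 2 * h (g a)) ^+ 2) ?sqr_ge0 //.
    by field.
  rewrite big_split /= -!mulr_sumr lerD2l ler_wpM2l // /E [leRHS](bigID P) /=.
  by rewrite lerDl; apply: sumr_ge0 => a _; apply: sqr_ge0.
have w_moved g P : involutive g ->
    \sum_(a | P a) h (g a) ^+ 2 = w (fun b => P (g b)).
  move=> gK; rewrite (reindex_inj (can_inj gK)) /=.
  by apply: eq_bigr => b _; rewrite gK.
have wE P : w P = \sum_a (P a)%:R * h a ^+ 2.
  rewrite /w big_mkcond; apply: eq_bigr => a _.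
  by case: (P a); rewrite ?mul1r ?mul0r.
have w_mono (P Q : pred (V * V)) : (forall a, P a -> Q a) -> w P <= w Q.
  move=> PQ; rewrite !wE; apply: ler_sum => a _; rewrite ler_wpM2r ?sqr_ge0 //.
  by rewrite ler_nat; have := PQ a; case: (P a) => // ->.
have w_disj (P P' Q : pred (V * V)) : (forall a, P a -> Q a) ->
    (forall a, P' a -> Q a) -> (forall a, P a -> ~~ P' a) -> w P + w P' <= w Q.
  move=> PQ P'Q PP'; rewrite !wE -big_split; apply: ler_sum => a _ /=.
  rewrite -mulrDl ler_wpM2r ?sqr_ge0 // -natrD ler_nat.
  have [Pa|_] := boolP (P a); first by rewrite (negPf (PP' a Pa)) PQ.
  by have [/P'Q->|] := boolP (P' a).
have E_ge0 g : 0 <= E g by apply: sumr_ge0 => a _; apply: sqr_ge0.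
have shear_up a : good a -> a.2 != 0 -> (deg a.1 <= deg a.2)%N -> X1 (shear a).
  by move=> /eqP/deg_lt ga a20 le12; rewrite /X1 /= addrC degD deg_mulX.
have shear1_up a : good a -> a.2 != 0 -> (deg a.1 <= deg a.2)%N -> X1 (shear1 a).
  move=> ga a20 le12; apply: (shear_up (a.1 + a.2, a.2)) => //=.
  by rewrite (leq_trans (degD_le _ _)) // geq_max le12 leqnn.
have X2_neq0 a : X2 a -> a.2 != 0 by rewrite -deg_gt0; apply: leq_ltn_trans.
have wX2 : w (fun a => X2 (shear a) && good (shear a)) +
           w (fun a => X2 (shear1 a) && good (shear1 a)) <= w X1.
  apply: w_disj => a.
  - by case/andP=> x2 ga; rewrite -[a]shearK shear_up ?(ltnW x2) ?X2_neq0.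
  - by case/andP=> x2 ga; rewrite -[a]shear1K shear1_up ?(ltnW x2) ?X2_neq0.
  case/andP=> lt2 _; apply/negP=> /andP[lt1 _]; move: lt1 lt2.
  (* if [shear b = shear1 c = a], the first coordinates [b.1] and [c.1] differ by
     [a.2], and cannot both have a smaller degree *)
  rewrite /X2 /= (addrAC a.1); set u := a.1 + _ => lt1 lt2.
  have : (deg a.2 <= deg (u + (u + a.2)))%N by rewrite addrA addvv add0r.
  rewrite leqNgt => /negP[]; apply: leq_ltn_trans (degD_le _ _) _.
  by rewrite gtn_max lt1 lt2.
have X2g_1 := w_le shear (fun a => X2 a && good a).
have X2g_2 := w_le shear1 (fun a => X2 a && good a).
have X1_2 := w_le swap X1.
have X3_1 := w_le shear X3.
rewrite w_moved in X2g_1; last exact: shearK.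
rewrite w_moved in X2g_2; last exact: shear1K.
rewrite w_moved in X1_2; last exact: swapK.
rewrite w_moved in X3_1; last exact: shearK.
have X3_X1 : w (fun a => X3 (shear a)) <= w X1.
  by apply: w_mono => a /and3P[/eqP e a0 ga]; rewrite -[a]shearK shear_up // e.
have X2_split : w (fun a => X1 (swap a)) <= w (fun a => X2 a && good a) + Ebad.
  by rewrite /w (bigID good) /= lerD //; apply: w_mono => a /andP[].
have X_cover a : a != 0 -> good a -> ~~ X1 a -> ~~ X2 a -> X3 a.
  rewrite /good /X1 /X2 /X3 -!leqNgt => a0 -> le12 le21.
  have e12 : deg a.1 = deg a.2 by apply/eqP; rewrite eqn_leq le12.
  rewrite e12 eqxx andbT /=; apply: contraNneq a0 => a20.
  have : deg a.1 == 0%N by rewrite e12 a20 -leqn0 leqNgt deg_gt0 eqxx.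
  rewrite -leqn0 leqNgt deg_gt0 negbK.
  by case: (a) a20 => [b c] /= -> /eqP->.
have total : \sum_a h a ^+ 2 <= w X1 + w (fun a => X2 a && good a) + w X3 + Ebad.
  rewrite -[Ebad]/(w (fun a => ~~ good a)) !wE -!big_split /=.
  apply: ler_sum => a _; have [->|a0] := eqVneq a 0.
    by rewrite h0 expr0n !mulr0 !addr0.
  rewrite -!mulrDl -!natrD -[leLHS]mul1r ler_wpM2r ?sqr_ge0 // (ler_nat _ 1).
  have [ga|] := boolP (good a); last by rewrite addnS.
  by have := X_cover a a0 ga; case: (X1 a) (X2 a) => [] [] //= ->.
have Ebad0 : 0 <= Ebad by apply: sumr_ge0 => a _; apply: sqr_ge0.
have := E_ge0 shear; have := E_ge0 shear1; have := E_ge0 swap.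
by lra.
Qed.
End Shears.

(** * Multigraphs of bounded degree with a small spectral ratio *)

Section BaseExpander.
Variables (R : realFieldType) (m : nat).
Local Notation n := m.+1.
Local Notation V := 'rV['F_2]_n.

Definition F2sign (c : 'F_2) : R := (-1) ^+ (c != 0).

Lemma F2signD c d : F2sign (c + d) = F2sign c * F2sign d.
Proof.
rewrite /F2sign; case: c d => [[|[|//]] ?] [[|[|//]] ?] /=;
  by rewrite ?mulrNN ?mul1r ?mulr1.
Qed.

Lemma F2sign_eq1 c : (F2sign c == 1) = (c == 0).
Proof.
rewrite /F2sign; case: (eqVneq c 0) => _; first by rewrite expr0 eqxx.
by rewrite expr1 eqNr oner_eq0.
Qed.

Definition dot (a x : V) : 'F_2 := (a *m x^T) 0 0.
Definition walsh (a x : V * V) : R := F2sign (dot a.1 x.1 + dot a.2 x.2).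

Lemma dotDl a b x : dot (a + b) x = dot a x + dot b x.
Proof. by rewrite /dot mulmxDl mxE. Qed.

Lemma dotDr a x y : dot a (x + y) = dot a x + dot a y.
Proof. by rewrite /dot linearD mulmxDr mxE. Qed.

Lemma dot_delta a i : dot a (delta_mx 0 i) = a 0 i.
Proof. by rewrite /dot trmx_delta -colE mxE. Qed.

Lemma dotC a x : dot a x = dot x a.
Proof. by rewrite /dot -[a *m _]trmxK trmx_mul trmxK mxE. Qed.

Lemma walshDl a b x : walsh (a + b) x = walsh a x * walsh b x.
Proof. by rewrite /walsh -F2signD !dotDl addrACA. Qed.

Lemma walshDr a x y : walsh a (x + y) = walsh a x * walsh a y.
Proof. by rewrite /walsh -F2signD !dotDr addrACA. Qed.

Lemma walsh_sqr a x : walsh a x ^+ 2 = 1.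
Proof. by rewrite /walsh /F2sign sqrr_sign. Qed.

Lemma walsh_nondegenerate x : x != 0 -> exists a, walsh a x != 1.
Proof.
have nz (v : V) : v != 0 -> exists a, dot a v != 0.
  move=> v0; have [i vi] : exists i, v 0 i != 0.
    apply/existsP; apply: contraNT v0 => /existsPn /= v0.
    by apply/eqP/rowP=> i; rewrite mxE; apply/eqP/negPn.
  by exists (delta_mx 0 i); rewrite dotC dot_delta.
have dot0 v : dot 0 v = 0 by rewrite /dot mul0mx mxE.
case: x => [y z]; have [->|/nz[a ya] _] := eqVneq y 0.
  have [->|/nz[a za] _] := eqVneq z 0; first by rewrite eqxx.
  by exists (0, a); rewrite /walsh F2sign_eq1 /= dot0 add0r.
by exists (a, 0); rewrite /walsh F2sign_eq1 /= dot0 addr0.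
Qed.

Definition mulX_adjoint (x : V) : V := x *m (lin1_mx (@mulX m))^T.

Lemma dot_mulX a x : dot (mulX a) x = dot a (mulX_adjoint x).
Proof.
by rewrite /dot /mulX_adjoint trmx_mul trmxK mulmxA mul_rV_lin1.
Qed.

(** The moves of the vertices whose adjoints on the characters are [shear] and
    [shear1]; [swap] is its own adjoint.  The character of [a] is -1 at the
    translation vector exactly when multiplying [a.2] by ['X] is truncated.  All
    moves are involutions, which makes [base_kernel] symmetric. *)
Definition shear_move (x : V * V) : V * V := (x.1, x.2 + mulX_adjoint x.1).
Definition shear1_move (x : V * V) : V * V := (x.1, x.2 + x.1 + mulX_adjoint x.1).
Definition translate (x : V * V) : V * V := x + (0, delta_mx 0 ord_max).

Lemma shear_moveK : involutive shear_move.
Proof. by move=> [x y]; rewrite /shear_move /= addvK. Qed.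

Lemma shear1_moveK : involutive shear1_move.
Proof. by move=> [x y]; rewrite /shear1_move /= addrAC addvK addvK. Qed.

Lemma translateK : involutive translate.
Proof. by move=> [x y]; rewrite /translate; congr (_, _); rewrite /= ?addr0 ?addvK. Qed.

(** The Fourier transform of a mean-zero function vanishes at the origin, so that
    [ping_pong] applies to it. *)
Lemma base_spectral_gap (f : V * V -> R) : \sum_x f x = 0 ->
  \sum_x f x ^+ 2 <= 100 * (\sum_x (f x - f (shear_move x)) ^+ 2 +
    \sum_x (f x - f (shear1_move x)) ^+ 2 + \sum_x (f x - f (swap x)) ^+ 2 +
    \sum_x (f x - f (translate x)) ^+ 2).
Proof.
move=> sf; pose h := fourier walsh f.
have h0 : h 0 = 0.
  rewrite /h /fourier -[RHS]sf; apply: eq_bigr => x _.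
  by rewrite /walsh /dot !mul0mx !mxE addr0 /F2sign eqxx mul1r.
have := ping_pong h0; rewrite parseval //; last exact: walsh_nondegenerate.
all: try exact: walshDl.
all: try exact: walshDr.
all: try exact: walsh_sqr.
have rotate (p q r s : 'F_2) : p + (q + r + s) = p + r + s + q.
  by rewrite !addrA [RHS]addrAC; congr (_ + _); apply: addrAC.
have diffE := fourier_diff_adjoint walshDl walshDr walsh_sqr walsh_nondegenerate f.
rewrite (diffE shear_move (@shear m) shear_moveK) => [|a x]; last first.
  by rewrite /walsh /= dotDl dotDr dot_mulX [in RHS]addrAC addrA.
rewrite (diffE shear1_move (@shear1 m) shear1_moveK) => [|a x]; last first.
  by rewrite /walsh /= !dotDl !dotDr dot_mulX; congr (F2sign _); apply: rotate.
rewrite (diffE (@swap m) (@swap m) (@swapK m)) => [|a x]; last by rewrite /walsh /= addrC.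
have : 4 * (\sum_(a : V * V | a.2 0 ord_max != 0) h a ^+ 2) =
    #|{: V * V}|%:R * \sum_x (f x - f (translate x)) ^+ 2.
  rewrite -(fourier_diff_translation walshDl walshDr walsh_sqr walsh_nondegenerate).
  rewrite mulr_sumr big_mkcond; apply: eq_bigr => a _.
  rewrite /walsh /dot /= -/(dot a.2 _) dot_delta trmx0 mulmx0 mxE add0r /F2sign.
  by case: eqP => _ /=; rewrite ?subrr ?mul0r ?expr0n //= expr1 /h; ring.
have N0 : 0 < #|{: V * V}|%:R :> R by rewrite ltr0n; apply/card_gt0P; exists 0.
set S := \sum_(a | _) _; move=> tE gap; rewrite -(ler_pM2l N0).
have S0 : 0 <= S by apply: sumr_ge0 => a _; apply: sqr_ge0.
have lin (N A B C D E : R) : N * A <= 100 * (N * B + N * C + N * D + S) ->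
    4 * S = N * E -> N * A <= N * (100 * (B + C + D + E)) by lra.
exact: lin gap tE.
Qed.

(** The identity is one of the five moves: if the sum of the five images of a
    function has nearly the largest possible norm, positive or negative eigenvalue
    alike, then the function is nearly invariant under each move. *)
Definition base_kernel (x y : V * V) : nat :=
  (x == y) + (shear_move x == y) + (shear1_move x == y) + (swap x == y) +
  (translate x == y).

Lemma base_kernel_regular : regular_kernel base_kernel 5.
Proof.
have invE g : involutive g -> forall x y : V * V, (g x == y) = (g y == x).
  by move=> gK x y; apply/eqP/eqP=> <-; rewrite gK.
split=> [x y|x].
  rewrite /base_kernel eq_sym (invE _ shear_moveK) (invE _ shear1_moveK).
  by rewrite (invE _ (@swapK m)) (invE _ translateK).
have sum_eq (z : V * V) : (\sum_y (z == y) = 1)%N.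
  by rewrite (bigD1 z) //= eqxx big1 // => y; rewrite eq_sym => /negPf->.
by rewrite /base_kernel !big_split /= !sum_eq.
Qed.

Lemma base_kernel_contracts :
  contracts (fun x y => (base_kernel x y)%:R) (25 - 100^-1 : R).
Proof.
move=> f sf; have gap := base_spectral_gap sf.
have sum_eq (z : V * V) : \sum_y (z == y)%:R * f y = f z.
  rewrite (bigD1 z) //= eqxx mul1r big1 ?addr0 // => y.
  by rewrite eq_sym => /negPf->; rewrite mul0r.
have sumK g : involutive g -> \sum_x f (g x) ^+ 2 = \sum_x f x ^+ 2.
  by move=> gK; rewrite [RHS](reindex_inj (can_inj gK)).
have rowE x : \sum_y (base_kernel x y)%:R * f y =
    f x + f (shear_move x) + f (shear1_move x) + f (swap x) + f (translate x).
  rewrite /base_kernel; under eq_bigr do rewrite !natrD !mulrDl.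
  by rewrite !big_split /= !sum_eq.
under eq_bigr do rewrite rowE.
have : \sum_x (f x + f (shear_move x) + f (shear1_move x) + f (swap x) +
      f (translate x)) ^+ 2 +
    (\sum_x (f x - f (shear_move x)) ^+ 2 + \sum_x (f x - f (shear1_move x)) ^+ 2 +
     \sum_x (f x - f (swap x)) ^+ 2 + \sum_x (f x - f (translate x)) ^+ 2) <=
    5 * (\sum_x f x ^+ 2 + \sum_x f (shear_move x) ^+ 2 +
      \sum_x f (shear1_move x) ^+ 2 + \sum_x f (swap x) ^+ 2 +
      \sum_x f (translate x) ^+ 2).
  rewrite -!big_split /= mulr_sumr; apply: ler_sum => x _.
  set a := f x; set b := f _; set c := f _; set d := f _; set e := f _.
  rewrite -subr_ge0 (_ : _ - _ = (b - c) ^+ 2 + (b - d) ^+ 2 + (b - e) ^+ 2 +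
    (c - d) ^+ 2 + (c - e) ^+ 2 + (d - e) ^+ 2); last by ring.
  by rewrite !addr_ge0 ?sqr_ge0.
rewrite (sumK _ shear_moveK) (sumK _ shear1_moveK) (sumK _ (@swapK m)).
by rewrite (sumK _ translateK); lra.
Qed.
End BaseExpander.

Section Power.
Variables (V : finType) (A : V -> V -> nat) (D : nat).
Fixpoint power_kernel s x y : nat :=
  if s is s'.+1 then (\sum_z A x z * power_kernel s' z y)%N else (x == y).

Hypothesis regA : regular_kernel A D.

Lemma power_kernel_regular s : regular_kernel (power_kernel s) (D ^ s).
Proof.
have [symA rowA] := regA; split=> [x y|x].
  (* a product of symmetric matrices is symmetric when they commute *)
  suff: power_kernel s x y = power_kernel s y x /\
      (\sum_z A x z * power_kernel s z y =
       \sum_z power_kernel s x z * A z y)%N by case.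
  elim: s x y => [|s IH] x y /=.
    split; first by rewrite eq_sym.
    rewrite (bigD1 y) //= eqxx muln1 big1 ?addn0 => [|z /negPf->]; last by rewrite muln0.
    by rewrite (bigD1 x) //= eqxx mul1n big1 ?addn0 // => z; rewrite eq_sym => /negPf->.
  have comm z t : (\sum_u A z u * power_kernel s u t =
      \sum_u power_kernel s z u * A u t)%N by case: (IH z t).
  split.
    rewrite comm; apply: eq_bigr => z _; rewrite mulnC symA.
    by case: (IH x z) => ->.
  under [RHS]eq_bigr do rewrite big_distrl /=.
  rewrite exchange_big; apply: eq_bigr => z _ /=.
  by rewrite comm big_distrr; apply: eq_bigr => u _ /=; rewrite mulnA.
elim: s x => [|s IH] x /=.
  by rewrite (bigD1 x) //= eqxx big1 // => y; rewrite eq_sym => /negPf->.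
rewrite exchange_big /=; under eq_bigr do rewrite -big_distrr IH /=.
by rewrite -big_distrl rowA expnS.
Qed.

Lemma power_kernel_contracts (R : realFieldType) (c : R) s : 0 <= c ->
  contracts (fun x y => (A x y)%:R) c ->
  contracts (fun x y => (power_kernel s x y)%:R) (c ^+ s).
Proof.
have [symA rowA] := regA; move=> c0 conA; elim: s => [|s IH] f sf /=.
  rewrite expr0 mul1r; apply: ler_sum => x _.
  rewrite (bigD1 x) //= eqxx mul1r big1 ?addr0 // => y.
  by rewrite eq_sym => /negPf->; rewrite mul0r.
have powE x : \sum_y (\sum_z A x z * power_kernel s z y)%N%:R * f y =
    \sum_z (A x z)%:R * \sum_y (power_kernel s z y)%:R * f y.
  under [RHS]eq_bigr do rewrite mulr_sumr.
  rewrite exchange_big; apply: eq_bigr => y _ /=.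
  by rewrite natr_sum mulr_suml; apply: eq_bigr => z _; rewrite natrM mulrA.
under eq_bigr do rewrite powE.
rewrite exprS -mulrA; apply: le_trans (ler_wpM2l c0 (IH f sf)); apply: conA.
have [symP rowP] := power_kernel_regular s.
rewrite exchange_big; under eq_bigr => y _.
  rewrite -mulr_suml -natr_sum (eq_bigr _ (fun i _ => symP i y)) rowP; over.
by rewrite -mulr_sumr sf mulr0.
Qed.
End Power.

(** Bernoulli's inequality for [1 + x]. *)
Lemma exists_pow_le (R : archiRealFieldType) (rho x eps : R) :
  0 <= rho -> 0 < x -> rho * (1 + x) <= 1 -> 0 < eps -> exists s, rho ^+ s <= eps.
Proof.
move=> rho0 x0 rhox eps0.
have bern s : rho ^+ s * (1 + s%:R * x) <= 1.
  elim: s => [|s IH]; first by rewrite expr0 mul0r addr0 mulr1.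
  apply: le_trans IH; rewrite exprSr -mulrA ler_wpM2l ?exprn_ge0 //.
  have sx0 : 0 <= s%:R * x by rewrite mulr_ge0 ?ler0n ?(ltW x0).
  apply: (@le_trans _ _ (rho * (1 + x) * (1 + s%:R * x))).
    rewrite -mulrA ler_wpM2l // -subr_ge0 (_ : _ - _ = s%:R * x * x).
      by rewrite mulr_ge0 ?sx0 ?(ltW x0).
    by rewrite -natr1; ring.
  by apply: ler_piMl => //; apply: addr_ge0; rewrite ?ler01.
have epsx : 0 < eps * x by rewrite mulr_gt0.
pose s := Num.bound (eps * x)^-1; exists s.
have : 1 <= eps * (1 + s%:R * x).
  rewrite mulrDr mulr1; apply: ler_wpDl; first exact: ltW.
  rewrite mulrCA mulrC -ler_pdivrMl // mulr1.
  by rewrite ltW // archi_boundP // invr_ge0 ltW.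
move=> le1; have := le_trans (bern s) le1; rewrite ler_pM2r //.
by rewrite ltr_pwDl ?mulr_ge0 ?ler0n ?(ltW x0).
Qed.

(** The graphs [H] to be blown up.  A power of [base_kernel] has a small spectral
    ratio; [off_diagonal] and [incidence_lift] make it a graph without edges inside
    the blocks [{b} * F^2].  The field has characteristic 2, so that the blocks are
    groups of exponent 2; the blocks have at least [D] elements, which leaves room
    for a Cayley graph of any degree below [D] on them. *)
Lemma dense_template (R : archiRealFieldType) (eps : R) : 0 < eps ->
  exists (F : finFieldType) (D : nat),
  [/\ forall x : F, x + x = 0, (1 < D)%N, (D <= #|F| ^ 2)%N &
    forall N, exists (B : finType) (H : rel (B * (F * F))),
    [/\ (N < #|B|)%N, symmetric H, forall b x y, H (b, x) (b, y) = false,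
        regular_kernel (fun u v => H u v : nat) D &
        contracts (fun u v => (H u v)%:R) (eps * D%:R ^+ 2)]].
Proof.
move=> eps0; pose rho : R := (25 - 100^-1) / 25.
(* 25 is the square of the degree of [base_kernel] *)
have [|||//|s rho_s] := @exists_pow_le R rho (1 / 2500) eps; rewrite /rho; try lra.
(* [b] is the degree of the complete graph used by [off_diagonal], and [e] makes
   [#|F|] exceed both [1 / eps] and the degree [b * D0] *)
pose D0 := (5 ^ s)%N; have D0_gt0 : (0 < D0)%N by rewrite expn_gt0.
pose b := Num.bound eps^-1.
have b_eps : 1 <= eps * b%:R.
  by rewrite -ler_pdivrMl // mulr1 ltW // archi_boundP // invr_ge0 ltW.
have b_gt0 : (0 < b)%N.
  by rewrite -(ltr_nat R) (lt_trans _ (archi_boundP _)) ?invr_gt0 // invr_ge0 ltW.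
pose e := (b * D0)%N.
have e_gt0 : (0 < e)%N by rewrite muln_gt0 b_gt0.
have [F charF cardF] := pPrimePowerField (isT : prime 2) e_gt0.
have e_lt : (e < #|F|)%N by rewrite cardF ltn_expl.
have b_le : (b <= e)%N by rewrite leq_pmulr.
have D0_le : (D0 <= e)%N by rewrite leq_pmull.
exists F, (#|F| * (b * D0))%N; split.
- by move=> x; rewrite addrr_pchar2.
- by rewrite (leq_trans _ (leq_pmulr _ e_gt0)) // (leq_trans _ e_lt).
- by rewrite -[(_ ^ 2)%N]/(#|F| * #|F|)%N leq_mul2l (ltnW e_lt) orbT.
move=> N.
pose B0 := ('rV['F_2]_N.+1 * 'rV['F_2]_N.+1)%type.
pose A : B0 -> B0 -> nat := power_kernel (@base_kernel N) s.
have regA : regular_kernel A D0 := power_kernel_regular (base_kernel_regular N) s.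
have conA : contracts (fun x y => (A x y)%:R) (eps * D0%:R ^+ 2).
  have c0 : 0 <= 25 - 100^-1 :> R by lra.
  have con := power_kernel_contracts (base_kernel_regular N) s c0
    (@base_kernel_contracts R N).
  move=> f sf; apply: le_trans (con f sf) _.
  rewrite ler_wpM2r ?sumr_ge0 // => [x _|]; first exact: sqr_ge0.
  have -> : (25 - 100^-1 : R) = rho * 25 by rewrite /rho divfK ?pnatr_eq0.
  have -> : D0%:R ^+ 2 = 25 ^+ s :> R by rewrite /D0 natrX exprAC -natrX.
  by rewrite exprMn ler_wpM2r ?exprn_ge0.
have [||regM conM] := regular_kernel_off_diagonal (Z := 'I_b.+1) (card_ord _)
  regA conA (c := eps * (b * D0)%:R ^+ 2).
- by rewrite natrM exprMn mulrCA.
- rewrite natrM exprMn mulrA ler_peMl ?sqr_ge0 // expr2 mulrA.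
  by rewrite (le_trans b_eps) // ler_peMr ?ler1n // (le_trans ler01).
have M_le p p' : (@off_diagonal _ 'I_b.+1 A p p' <= #|F|)%N.
  apply: leq_trans (_ : D0 <= _)%N; last exact: leq_trans D0_le (ltnW e_lt).
  rewrite -(regA.2 p.1) /off_diagonal (bigD1 p'.1) //=.
  by case: (_ != _); rewrite ?mul1n ?leq_addr.
have [||regH conH] := regular_kernel_incidence_lift (F := F) M_le regM conM
  (c := eps * (#|F| * (b * D0))%:R ^+ 2).
- by rewrite [in leRHS]natrM exprMn [leRHS]mulrCA.
- rewrite [in leRHS]natrM exprMn mulrC [leRHS]mulrA ler_wpM2r ?sqr_ge0 //.
  rewrite expr2 mulrA ler_peMl // (le_trans b_eps) // ler_wpM2l ?(ltW eps0) //.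
  by rewrite ler_nat (leq_trans b_le (ltnW e_lt)).
exists (B0 * 'I_b.+1)%type, (incidence_lift (F := F) (@off_diagonal _ 'I_b.+1 A)).
split=> //.
- rewrite !card_prod card_ord card_mx card_Fp //= mul1n.
  have : (N < 2 ^ N.+1)%N by apply: ltn_trans (ltn_expl _ _).
  nia.
- by move=> p p'; rewrite /incidence_lift regM.1 [p.2.2 + _]addrC [p.2.1 * _]mulrC.
- by move=> u x y; rewrite /incidence_lift /off_diagonal /= eqxx mul0n take0.
Qed.

(** * Counting the induced subgraphs of a blow-up *)

(** If sets with the same invariant are moved to each other by automorphisms, each
    invariant meets at most one isomorphism class of induced subgraphs.  The graph
    [H] is a copy of [G] with more convenient vertices. *)
Lemma mu_le_of_invariant (V W J : finType) (G : sgraph V) (H : sgraph W)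
    (inv : {set W} -> J) : graph_iso G H ->
  (forall S T, inv S = inv T -> exists phi : W -> W,
     [/\ injective phi, forall x y, adj H (phi x) (phi y) = adj H x y
       & forall x, (phi x \in T) = (x \in S)]) ->
  (mu G <= #|J|)%N.
Proof.
move=> [e [e' eK e'K] eG] invP.
have induced_of_inv (S T : {set V}) : inv (e @: S) = inv (e @: T) -> induced_iso G S T.
  move=> /invP[phi [phi_inj phiH phiST]]; apply/asboolP.
  pose psi x := e' (phi (e x)).
  have psi_inj : injective psi by move=> x y /(can_inj e'K)/phi_inj/(can_inj eK).
  have psiST x : (psi x \in T) = (x \in S).
    have e_inj := can_inj eK.
    by rewrite -(mem_imset _ _ e_inj) /psi e'K phiST mem_imset.
  have psi_in (x : {x | x \in S}) : psi (val x) \in T by rewrite psiST (valP x).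
  exists (fun x => exist (fun y => y \in T) (psi (val x)) (psi_in x)).
    apply: inj_card_bij => [x y /(congr1 val)/= /psi_inj/val_inj //|].
    rewrite !card_sig.
    have -> : #|[pred x | x \in T]| = #|psi @: S|.
      apply: eq_card => y; rewrite !inE; apply/idP/imsetP=> [yT|[x xS ->]].
        2: by rewrite psiST.
      have [g _ gK] := injF_bij psi_inj.
      by exists (g y); rewrite ?gK // -psiST gK.
    by rewrite card_imset.
  by move=> x y /=; rewrite -eG !e'K phiH eG.
pose rep (X : {set {set V}}) := inv (e @: odflt set0 [pick S in X]).
have isoP S T U : induced_iso G S T -> induced_iso G S U = induced_iso G T U.
  by case: (induced_iso_equiv G S T U).
have iso_refl S : induced_iso G S S by case: (induced_iso_equiv G S S S).
pose cls (S : {set V}) := [set T in [set: {set V}] | induced_iso G S T].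
have rep_cls S : exists2 T, induced_iso G S T & rep (cls S) = inv (e @: T).
  rewrite /rep; case: pickP => [T|/(_ S)]; rewrite !inE /=; first by exists T.
  by rewrite iso_refl.
(* reading the invariant off a member of each class is injective on classes *)
rewrite /mu; set P := equivalence_partition _ _.
suff rep_inj : {in P &, injective rep} by rewrite -(card_in_imset rep_inj) max_card.
move=> X Y /imsetP[S _ ->] /imsetP[T _ ->].
rewrite -/(cls S) -/(cls T).
have [S' SS' ->] := rep_cls S; have [T' TT' ->] := rep_cls T.
move=> /induced_of_inv ST'; apply/setP=> U; rewrite !inE /=.
by rewrite (isoP _ _ _ SS') (isoP _ _ _ ST') -(isoP _ _ _ TT').
Qed.

Lemma perm_of_equal_fibres (k : nat) (Y : eqType) (a b : 'I_k -> Y) :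
  (forall y, #|[set i | a i == y]| = #|[set i | b i == y]|) ->
  exists s : {perm 'I_k}, forall i, a i = b (s i).
Proof.
move=> fib; have : perm_eq [tuple a i | i < k] [tuple b i | i < k].
  apply/allP=> y _ /=; apply/eqP; have := fib y.
  by rewrite !cardsE !cardE !enumT /enum_mem !size_filter !count_map.
move/tuple_permP=> [s /val_inj abs]; exists s => i.
by have := congr1 (fun t => tnth t i) abs; rewrite !tnth_mktuple.
Qed.

Section Blowup.
Variables (B : finType) (Q : finZmodType) (H : rel (B * Q)) (S : {set Q}) (k : nat).
Hypotheses (Hsym : symmetric H) (Hout : forall b x y, H (b, x) (b, y) = false).
Hypotheses (charQ : forall x : Q, x + x = 0) (S0 : 0 \notin S).

Local Notation U := (B * Q * 'I_k)%type.

(** The blow-up proper: [(u, i)] for [i : 'I_k] are independent twins. *)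
Definition joined (p p' : U) := H p.1 p'.1.
(** Inside each copy [(b, i)] of a block [b], on which [H] has no edge, the Cayley
    graph of [S] is added, to adjust the degree.  As [Q] has exponent 2, every set
    [S] without 0 yields an undirected graph without loops. *)
Definition mended (p p' : U) :=
  [&& p.1.1 == p'.1.1, p.2 == p'.2 & p.1.2 + p'.1.2 \in S].

Fact blowup_sym : symmetric (fun p p' => joined p p' || mended p p').
Proof.
by move=> p p'; rewrite /joined /mended Hsym eq_sym (eq_sym p.2) (addrC p.1.2).
Qed.

Fact blowup_irr : irreflexive (fun p p' => joined p p' || mended p p').
Proof.
by move=> [[b x] i]; rewrite /joined /mended /= Hout charQ (negPf S0) !andbF.
Qed.

Definition blowup := SGraph blowup_sym blowup_irr.

Lemma blowup_adjE p p' : adj blowup p p' = (joined p p' + mended p p')%N :> nat.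
Proof.
case: p p' => [[b x] i] [[b' x'] i']; rewrite /= /joined /mended /=.
by have [<-|_] := eqVneq b b'; rewrite ?Hout ?orbF ?addn0.
Qed.

Lemma regular_kernel_mended : regular_kernel (fun p p' => mended p p' : nat) #|S|.
Proof.
split=> [p p'|[[b x] i]].
  by rewrite /mended eq_sym (eq_sym p.2) (addrC p.1.2).
rewrite -big_mkcond /= sum1_card.
have inj : injective (fun y : Q => (b, x + y, i)) by move=> y z [] /addrI.
rewrite -(card_imset _ inj); apply: eq_card => -[[b' x'] i'].
rewrite [LHS]unfold_in /mended /=.
apply/and3P/imsetP => [[/eqP<- /eqP<- xS]|[y yS [-> -> ->]]].
  by exists (x + x') => //; rewrite addrA charQ add0r.
by rewrite !eqxx addrA charQ add0r.
Qed.

Lemma regular_kernel_joined (R : realFieldType) (D : nat) (th c : R) :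
  (0 < k)%N -> regular_kernel (fun u v => H u v : nat) D ->
  contracts (fun u v => (H u v)%:R) th -> 0 <= c -> k%:R ^+ 2 * th <= c ->
  regular_kernel (fun p p' => joined p p' : nat) (k * D) /\
  contracts (fun p p' => (joined p p')%:R) c.
Proof.
move=> k0 regH conH c0 thc.
apply: (regular_kernel_cloud (tau := 0) _ regH _ _ conH); rewrite ?mulr0 ?card_ord //.
- by move=> p p'; rewrite /joined Hsym.
- by move=> u v i; rewrite /joined /= sum_nat_const card_ord.
- move=> u v f sf; rewrite mulr0 mul0r big1 // => i _.
  by rewrite /joined /= -mulr_sumr sf mulr0 expr0n.
Qed.

Lemma regular_kernel_blowup (R : realFieldType) (D : nat) (th : R) :
  (0 < k)%N -> regular_kernel (fun u v => H u v : nat) D ->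
  contracts (fun u v => (H u v)%:R) th -> 0 <= th ->
  regular blowup (k * D + #|S|) /\
  contracts (fun p p' => (adj blowup p p')%:R)
    (2 * (k%:R ^+ 2 * th) + 2 * #|S|%:R ^+ 2).
Proof.
move=> k0 regH conH th0.
have c0 : 0 <= k%:R ^+ 2 * th by rewrite mulr_ge0 ?sqr_ge0.
have [[symJ rowJ] conJ] := regular_kernel_joined k0 regH conH c0 (lexx _).
have regM := regular_kernel_mended; split.
  move=> p; rewrite cardsE -sum1_card big_mkcond /= -(rowJ p) -(regM.2 p) -big_split.
  by apply: eq_bigr => p' _; rewrite /= -blowup_adjE.
move=> f sf; have := contracts_add conJ (fun f => regular_kernel_bounded f regM) sf.
by under eq_bigr do under eq_bigr do rewrite -natrD -blowup_adjE.
Qed.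

Definition fibre (T : {set U}) (b : B) (i : 'I_k) : {set Q} :=
  [set x | (b, x, i) \in T].
(** For each block, the multiset of the traces of [T] on the [k] copies of that
    block, given by its multiplicities. *)
Definition profile (T : {set U}) : {ffun B * {set Q} -> 'I_k.+1} :=
  [ffun p => inord #|[set i | fibre T p.1 i == p.2]|].

(** The copies of each block may be permuted freely, and independently for
    different blocks: the profile of a set determines the set up to
    automorphism. *)
Lemma mu_blowup (V : finType) (G : sgraph V) :
  graph_iso G blowup -> (mu G <= k.+1 ^ (#|B| * 2 ^ #|Q|))%N.
Proof.
have cardP : #|{set Q}| = (2 ^ #|Q|)%N.
  by rewrite -cardsT -powersetT card_powerset cardsT.
move=> isoG; rewrite -cardP -[k.+1]card_ord -card_prod -card_ffun.
apply: (mu_le_of_invariant (inv := profile) isoG) => T T' TT'.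
have /choice[s sP] : forall b, exists s : {perm 'I_k},
    forall i, fibre T b i = fibre T' b (s i).
  move=> b; apply: perm_of_equal_fibres => X.
  have := congr1 (fun h : {ffun _ -> 'I_k.+1} => h (b, X) : nat) TT'; rewrite !ffunE.
  by rewrite !inordK // ltnS -[X in (_ <= X)%N]card_ord max_card.
exists (fun p => (p.1, s p.1.1 p.2)); split.
- by move=> [[b x] i] [[b' x'] i'] /= [-> ->] /perm_inj->.
- move=> [[b x] i] [[b' x'] i'] /=; rewrite /joined /mended /=.
  by have [->|] := eqVneq b b'; rewrite // (inj_eq perm_inj).
- by move=> [[b x] i]; have /setP/(_ x) := sP b i; rewrite !inE.
Qed.
End Blowup.

(** * The graphs of degree d *)

Lemma relabel (W : finType) (H : sgraph W) :
  exists2 G : sgraph 'I_#|W|, graph_iso G H &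
    (forall d, regular H d -> regular G d) /\
    forall (R : realFieldType) (c : R), contracts (fun x y => (adj H x y)%:R) c ->
      contracts (fun i j => (adj G i j)%:R) c.
Proof.
pose a (i j : 'I_#|W|) := adj H (enum_val i) (enum_val j).
have a_sym : symmetric a by move=> i j; apply: adj_sym.
have a_irr : irreflexive a by move=> i; apply: adj_irr.
have bij := (@enum_val_bij W).
exists (SGraph a_sym a_irr); first by exists enum_val.
split=> [d regH i|R c conH f sf].
  rewrite -(regH (enum_val i)) -(card_imset _ enum_val_inj); apply: eq_card => y.
  rewrite inE; apply/imsetP/idP => [[j]|Hy]; first by rewrite inE => ? ->.
  by exists (enum_rank y); rewrite ?inE /= /a ?enum_rankK.
have sumE (g : W -> R) : \sum_(i < #|W|) g (enum_val i) = \sum_x g x.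
  by rewrite [RHS](reindex _ (onW_bij _ bij)).
have sg : \sum_x f (enum_rank x) = 0.
  by rewrite -sumE -[RHS]sf; apply: eq_bigr => i _; rewrite enum_valK.
have := conH _ sg; rewrite -!sumE.
under eq_bigr do rewrite -sumE.
under eq_bigr do under eq_bigr do rewrite enum_valK.
by under [X in _ <= _ * X]eq_bigr do rewrite enum_valK.
Qed.

Theorem theorem5 (R : realType) (delta : R) (hdelta : 0 < delta) :
  exists2 C : R, 0 < C &
    exists d1 : nat, forall d : nat, (d1 <= d)%N ->
      forall N : nat, exists2 n : nat, (N < n)%N &
        exists (lambda : R) (G : sgraph 'I_n),
          [/\ ndl_graph d lambda G,
              lambda / d%:R <= delta &
              (mu G)%:R <= expR (C * n%:R * ln d%:R / d%:R)].
Proof.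
(* a bound below 1 makes the eigenvalue [d] simple *)
pose dl := Num.min delta (1 / 2).
have dl0 : 0 < dl by rewrite lt_min hdelta /=; lra.
have dl1 : dl < 1 by rewrite gt_min; apply/orP; right; lra.
have dl_le : dl <= delta by rewrite ge_min lexx.
have [|F [D [char2 D_gt1 D_le tmpl]]] := @dense_template R (dl ^+ 2 / 4).
  by rewrite divr_gt0 ?exprn_gt0.
pose q2 := #|{: F * F}|.
have q2E : q2 = (#|F| ^ 2)%N by rewrite /q2 card_prod.
(* with [M] blocks, [mu G <= d ^ (M 2 ^ q2)] and [M <= n / k <= 2 D n / d] *)
exists ((2 ^ q2)%:R * (2 * D%:R)).
  by rewrite mulr_gt0 ?mulr_gt0 ?ltr0n ?expn_gt0 // (ltnW D_gt1).
(* then [r < D] contributes at most [dl / 2] to the ratio *)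
exists (Num.bound (2 * D%:R / dl)); move=> d d_ge N.
have d_big : 2 * D%:R <= dl * d%:R.
  rewrite -ler_pdivrMl // mulrC.
  apply: le_trans (_ : (Num.bound (2 * D%:R / dl))%:R <= _); last by rewrite ler_nat.
  by apply/ltW/archi_boundP; rewrite divr_ge0 ?mulr_ge0 ?ler0n ?(ltW dl0).
have D_gt0 : (0 < D)%N := ltnW D_gt1.
have D0 : 0 < D%:R :> R by rewrite ltr0n.
have d_gt : (2 * D <= d)%N.
  by rewrite -(ler_nat R) natrM (le_trans d_big) // ler_piMl ?ler0n ?(ltW dl1).
have D_le_d : (D <= d)%N by rewrite (leq_trans _ d_gt) ?leq_pmull.
have d_gt0 : (0 < d)%N := leq_trans D_gt0 D_le_d.
have d0 : 0 < d%:R :> R by rewrite ltr0n.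
pose k := (d %/ D)%N; pose r := (d %% D)%N.
have dE : (d = k * D + r)%N by exact: divn_eq.
have r_lt : (r < D)%N by rewrite ltn_mod.
have k_gt0 : (0 < k)%N by rewrite divn_gt0.
have [B [H [B_gt Hsym Hout regH conH]]] := tmpl N.
have char2F (x : F * F) : x + x = 0 by case: x => x y; congr (_, _); apply: char2.
pose S : {set F * F} := [set x in take r (enum [set~ (0 : F * F)])].
have S0 : 0 \notin S.
  by rewrite inE; apply/negP=> /mem_take; rewrite mem_enum !inE eqxx.
have cardS : #|S| = r.
  rewrite cardsE (card_uniqP _) ?take_uniq ?enum_uniq // size_takel // -cardE.
  have q2_gt0 : (0 < #|F| ^ 2)%N := leq_trans D_gt0 D_le.
  by rewrite cardsC1 -/q2 q2E -ltnS prednK // (leq_trans r_lt D_le).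
pose G0 := blowup k Hsym Hout char2F S0.
have th0 : 0 <= dl ^+ 2 / 4 * D%:R ^+ 2 by rewrite mulr_ge0 ?divr_ge0 ?sqr_ge0.
have [reg0 con0] := regular_kernel_blowup Hsym Hout char2F S0 k_gt0 regH conH th0.
have [G isoG [/(_ _ reg0) regG /(_ _ _ con0) conG]] := relabel G0.
have mu_le := mu_blowup isoG.
rewrite cardS in regG conG; rewrite -dE in regG.
set c := 2 * _ + _ in conG.
have c_le : c <= (dl * d%:R) ^+ 2.
  have kD : k%:R * D%:R <= d%:R :> R by rewrite -natrM ler_nat leq_divM.
  have rD : 2 * r%:R <= dl * d%:R.
    by apply: le_trans d_big; rewrite ler_pM2l // ler_nat ltnW.
  have kD2 : (k%:R * D%:R) ^+ 2 <= d%:R ^+ 2 :> R.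
    by rewrite ler_pXn2r ?nnegrE ?mulr_ge0 ?ler0n.
  have rD2 : (2 * r%:R) ^+ 2 <= (dl * d%:R) ^+ 2.
    by rewrite ler_pXn2r ?nnegrE ?mulr_ge0 ?ler0n // ltW.
  have dkD2 : dl ^+ 2 * (k%:R * D%:R) ^+ 2 <= (dl * d%:R) ^+ 2.
    by rewrite [leRHS]exprMn ler_wpM2l ?sqr_ge0.
  have cE : c = dl ^+ 2 * (k%:R * D%:R) ^+ 2 / 2 + (2 * r%:R) ^+ 2 / 2.
    by rewrite /c; field.
  by rewrite cE; lra.
have c_lt : c < d%:R ^+ 2.
  apply: le_lt_trans c_le _; rewrite ltr_pXn2r ?nnegrE ?mulr_ge0 ?ler0n ?(ltW dl0) //.
  by rewrite gtr_pMl.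
have q2_gt1 : (1 < q2)%N by rewrite q2E (leq_trans D_gt1 D_le).
have nE : #|{: B * (F * F) * 'I_k}| = (#|B| * (q2 * k))%N.
  by rewrite card_prod card_prod card_ord mulnA.
exists #|{: B * (F * F) * 'I_k}|.
  by rewrite nE (leq_trans B_gt) // leq_pmulr // muln_gt0 k_gt0 (ltnW q2_gt1).
have n_gt1 : (1 < #|{: B * (F * F) * 'I_k}|)%N.
  rewrite nE mulnCA (leq_trans q2_gt1) // leq_pmulr // muln_gt0 k_gt0.
  by rewrite (leq_ltn_trans _ B_gt).
have [lambda [ndl l0 l_le]] := ndl_of_contracts n_gt1 regG c_lt conG.
exists lambda, G; split=> //.
  rewrite ler_pdivrMr //; apply: le_trans (_ : dl * d%:R <= _).
    2: by rewrite ler_wpM2r // ltW.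
  by rewrite -(@ler_pXn2r _ 2) ?nnegrE ?mulr_ge0 ?(ltW dl0) ?ler0n // (le_trans l_le).
apply: (@le_trans _ _ (k.+1 ^ (#|B| * 2 ^ q2))%:R); first by rewrite ler_nat.
have k1 : 0 < k.+1%:R :> R by rewrite ltr0n.
rewrite natrX -[k.+1%:R]lnK ?posrE // -expRM_natl ler_expR.
have kd : (k.+1 <= d)%N by apply: ltn_Pdiv.
have lnd : ln k.+1%:R <= ln d%:R :> R by rewrite ler_ln ?posrE // ler_nat.
have lnd0 : 0 <= ln d%:R :> R by rewrite ln_ge0 // ler1n.
apply: (@le_trans _ _ ((#|B| * 2 ^ q2)%:R * ln d%:R)).
  by rewrite ler_wpM2l ?ler0n.
rewrite mulrAC ler_wpM2r // ler_pdivlMr //.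
rewrite nE -!natrM ler_nat.
have dk : (d <= 2 * D * k)%N.
  rewrite (leq_trans (ltnW (ltn_ceil d D_gt0))) // mulnAC leq_mul2r mul2n -addnn.
  by rewrite -addn1 leq_add2l k_gt0 orbT.
rewrite mulnC; apply: leq_trans (_ : 2 * D * k * (#|B| * 2 ^ q2) <= _)%N.
  by rewrite leq_mul2r dk orbT.
rewrite (_ : _ * (_ * (q2 * k)) = (2 * D * k * (#|B| * 2 ^ q2)) * q2)%N.
  2: by ring.
by rewrite leq_pmulr // (ltnW q2_gt1).
Qed.
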